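(* Let $(M,g)$ be a semi-Riemannian manifold with $\dim M = n \geq 4$ and let $A$ be a symmetric $(0,2)$-tensor on $M$. Let ${\mathcal U}_{A}\subset M$ be the set of points of $M$ at which $A \neq \frac{\mathrm{tr}_{g}(A)}{n}\, g$. (i) If $$\mathrm{rank}(A-\alpha\, g) = 1$$ on ${\mathcal U}_{A}$, where $\alpha$ is some function on ${\mathcal U}_{A}$, then on ${\mathcal U}_{A}$ $$g\wedge A^{2} + \frac{n-2}{2}\, A\wedge A - \mathrm{tr}_{g}(A)\, g\wedge A + \frac{(\mathrm{tr}_{g}(A))^{2}-\mathrm{tr}_{g}(A^{2})}{2(n-1)}\, g\wedge g = 0$$ and $$A^{2} - \frac{\mathrm{tr}_{g}(A^{2})}{n}\, g = \left(\mathrm{tr}_{g}(A)-(n-2)\alpha\right)\left(A-\frac{\mathrm{tr}_{g}(A)}{n}\, g\right).$$ (ii) If $$g\wedge A^{2} + \frac{n-2}{2}\, A\wedge A - \mathrm{tr}_{g}(A)\, g\wedge A + \frac{(\mathrm{tr}_{g}(A))^{2}-\mathrm{tr}_{g}(A^{2})}{2(n-1)}\, g\wedge g = 0$$ on ${\mathcal U}_{A}$, then there is a function $\rho$ on ${\mathcal U}_{A}$ such that on ${\mathcal U}_{A}$ $$A^{2}-\frac{\mathrm{tr}_{g}(A^{2})}{n}\, g = \rho\left(A-\frac{\mathrm{tr}_{g}(A)}{n}\, g\right)$$ and $$\left(A-\frac{\mathrm{tr}_{g}(A)-\rho}{n-2}\, g\right)\wedge\left(A-\frac{\mathrm{tr}_{g}(A)-\rho}{n-2}\,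 g\right)=0.$$
   Context: Manifolds are connected, paracompact, of class $C^\infty$; a semi-Riemannian metric $g$ is nondegenerate of arbitrary signature. For a symmetric $(0,2)$-tensor $A$, let ${\mathcal A}$ be the endomorphism with $g({\mathcal A}X,Y)=A(X,Y)$; then $A^{2}(X,Y)=A({\mathcal A}X,Y)$, and $\mathrm{tr}_{g}(A)$, $\mathrm{tr}_g(A^2)$ denote the traces with respect to $g$. The Kulkarni-Nomizu product of symmetric $(0,2)$-tensors $A,B$ is $$(A\wedge B)(X_1,X_2,X_3,X_4)=A(X_1,X_4)B(X_2,X_3)+A(X_2,X_3)B(X_1,X_4)-A(X_1,X_3)B(X_2,X_4)-A(X_2,X_4)B(X_1,X_3).$$ *)

(* Defs.v *)
From HB Require Import structures.
From mathcomp Require Import all_boot all_order all_algebra.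
From mathcomp Require Import all_classical all_reals all_analysis.
Set Implicit Arguments.
Unset Strict Implicit.
Unset Printing Implicit Defensive.
Import Order.TTheory GRing.Theory Num.Theory.
Import numFieldNormedType.Exports.
Local Open Scope classical_set_scope.
Local Open Scope ring_scope.

Section Calculus.
Variables (R : realType) (n : nat) (W : normedModType R).

(* [Ck k D f] is meant for open [D]; the values of [f] outside [D] are then
   irrelevant, and [Ck k D f] says that all iterated partial derivatives of
   order [k] exist and are continuous on [D]. *)
Fixpoint Ck (k : nat) (D : set 'rV[R]_n) (f : 'rV[R]_n -> W) : Prop :=
  if k is k'.+1 then
    forall i : 'I_n,
      (forall x, D x -> derivable f x 'e_i) /\
      Ck k' D (fun x => 'D_('e_i) f x)
  else forall x, D x -> {for x, continuous f}.

Definition Cinfty (D : set 'rV[R]_n) (f : 'rV[R]_n -> W) : Prop :=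
  forall k, Ck k D f.

End Calculus.

Definition locally_finite (T : topologicalType) (V : set (set T)) : Prop :=
  forall x : T, exists2 N, nbhs x N &
    finite_set [set B | V B /\ B `&` N !=set0].

Definition open_cover (T : topologicalType) (U : set (set T)) : Prop :=
  (forall B, U B -> open B) /\ \bigcup_(B in U) B = [set: T].

Definition paracompact (T : topologicalType) : Prop :=
  hausdorff_space T /\
  forall U : set (set T), open_cover U ->
    exists V : set (set T),
      [/\ open_cover V,
          forall B, V B -> exists2 C, U C & B `<=` C &
          locally_finite V].

(* A homeomorphism [coord] from the open set [dom] onto an open set of R^n.
   Both maps are total: only [coord] on [dom] and [chart_inv] on
   [coord @` dom] are meaningful. *)
Record chart (R : realType) (n : nat) (T : topologicalType) := Chart {
  dom : set T;
  coord : T -> 'rV[R]_n;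
  chart_inv : 'rV[R]_n -> T;
  dom_open : open dom;
  img_open : open (coord @` dom);
  coordK : forall p, dom p -> chart_inv (coord p) = p;
  coord_continuous : forall p, dom p -> {for p, continuous coord};
  chart_inv_continuous :
    forall x, (coord @` dom) x -> {for x, continuous chart_inv} }.

Definition transition (R : realType) (n : nat) (T : topologicalType)
  (c d : chart R n T) : 'rV[R]_n -> 'rV[R]_n := coord d \o chart_inv c.

Record manifold (R : realType) (n : nat) := Manifold {
  points :> topologicalType;
  manifold_connected : connected [set: points];
  manifold_paracompact : paracompact points;
  atlas : set (chart R n points);
  atlas_cover : forall p, exists c, atlas c /\ dom c p;
  atlas_smooth : forall c d, atlas c -> atlas d ->
    Cinfty (coord c @` (dom c `&` dom d)) (transition c d) }.

Section Tensors.
Variables (R : realType) (n : nat) (M : manifold R n).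

Definition chart_at (p : M) : chart R n M := projT1 (cid (atlas_cover p)).

(* A tangent vector at [p] is represented by its components in the chart
   [chart_at p]; components in the other charts are obtained through
   [coord_vector]. *)
Definition tangent (p : M) : vectType R := 'rV[R]_n.

(* The i-th coordinate vector at [p] of the chart [c], where [p] is in the
   domain of [c]. *)
Definition coord_vector (c : chart R n M) (p : M) (i : 'I_n) : tangent p :=
  'D_('e_i) (transition c (chart_at p)) (coord c p).

(* R^o is R seen as a module over itself: functions into it form an R-module,
   so that [+], [-] and [*:] below are the pointwise operations on tensors. *)
Definition form2 (p : M) := tangent p -> tangent p -> R^o.

Record sym_tensor := SymTensor {
  tensor_form : forall p : M, {symmetric (tangent p)};
  tensor_smooth : forall c, atlas c -> forall i j : 'I_n,
    Cinfty (coord c @` dom c)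
      (fun x => let p := chart_inv c x in
         tensor_form p (coord_vector c p i) (coord_vector c p j) : R) }.

Definition tensor_at (A : sym_tensor) (p : M) : form2 p :=
  fun X Y => tensor_form A p X Y.

End Tensors.

Coercion tensor_at : sym_tensor >-> Funclass.

Section PointwiseAlgebra.
Variables (R : realType) (n : nat).
Local Notation V := 'rV[R]_n.
Implicit Types g A B : V -> V -> R^o.

(* Endomorphisms of R^n are given by matrices acting on row vectors from the
   right.  [endo g A] is the endomorphism [E] with [g (E X) Y = A X Y]; see
   [endoP] and [endo_unique]. *)
Definition endo g A : 'M[R]_n :=
  xget 0 [set E : 'M[R]_n | forall X Y, g (X *m E) Y = A X Y].

Definition sq g A : V -> V -> R^o := fun X Y => A (X *m endo g A) Y.

Definition tr g A : R := \tr (endo g A).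

Definition rank_form A : nat := \rank (matrix_of_form A).

Definition KN A B : V -> V -> V -> V -> R^o := fun X1 X2 X3 X4 =>
  A X1 X4 * B X2 X3 + A X2 X3 * B X1 X4
  - A X1 X3 * B X2 X4 - A X2 X4 * B X1 X3.

Lemma nondegenerateP (g : {symmetric V}) :
  nondegenerate g <-> forall X, (forall Y, g X Y = 0) -> X = 0.
Proof.
split=> [/eqP gnd X gX0|gnd].
- apply/eqP; rewrite -memv0 -gnd.
  by apply/negPn/negP => /mem_orthovPn[Y _]; rewrite gX0 eqxx.
- apply/eqP/vspaceP => X; rewrite memv0; apply/idP/eqP => [XV|->].
    apply: gnd => Y; apply/eqP/negPn/negP => gXY.
    suff : X \notin orthov g fullv by rewrite XV.
    by apply/mem_orthovPn; exists Y; rewrite ?memvf.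
  exact: mem0v.
Qed.

Lemma symmetric_mxE (g : {symmetric V}) (X Y : V) :
  g X Y = (X *m matrix_of_form g *m Y^T) 0 0.
Proof.
rewrite -[LHS]matrix_of_formK /form_of_matrix map_mx_id //.
by rewrite /mxtrace big_ord1.
Qed.

Lemma nondegenerate_unit (g : {symmetric V}) :
  nondegenerate g -> matrix_of_form g \in unitmx.
Proof.
move=> /nondegenerateP gnd; rewrite -row_free_unit -kermx_eq0.
apply/eqP/row_matrixP => i; rewrite row0; apply: gnd => Y.
by rewrite symmetric_mxE -row_mul mulmx_ker row0 mul0mx mxE.
Qed.

Lemma endo_unique (g : {symmetric V}) A (E : 'M[R]_n) :
  nondegenerate g -> (forall X Y, g (X *m E) Y = A X Y) -> endo g A = E.
Proof.
move=> /nondegenerateP gnd EA; rewrite /endo.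
case: xgetP => [F _ FA|/(_ E)//].
apply/row_matrixP => i; rewrite !rowE; apply/eqP; rewrite -subr_eq0; apply/eqP.
by apply: gnd => Y; rewrite linearBl /= FA EA subrr.
Qed.

Lemma endoP (g A : {symmetric V}) X Y :
  nondegenerate g -> g (X *m endo g A) Y = A X Y.
Proof.
move=> gnd.
have EA X' Y' :
    g (X' *m (matrix_of_form A *m invmx (matrix_of_form g))) Y' = A X' Y'.
  rewrite !symmetric_mxE -!mulmxA (mulmxA (invmx _)) mulVmx ?mul1mx //.
  exact: nondegenerate_unit.
by rewrite (endo_unique gnd EA) EA.
Qed.

End PointwiseAlgebra.

(* Main.v *)
(* Everything is pointwise linear algebra.  Let E be the endomorphism of A.
   Raising indices, the curvature-like identity says that, on bivectors,
   (n-2) EX ^ EY + X ^ SY + SX ^ Y = 0 with S = E^2 - tr(E) E + c, and this form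
   of the identity is stable under E -> E - m: only the coefficients of S change.

   (i) If E - alpha is of rank one, both sides are explicit, since then
   E^2 lies in the span of E and 1.

   (ii) Choose X with X, EX independent.  Putting Y = EX gives
   E^2 X = rho EX + sigma X.  For m = (tr(E) - rho)/(n-2) and N = E - m, the
   shifted S maps X to a multiple of X, and the identity at (X, Y) for
   arbitrary Y yields that NY is a multiple of NX.  Hence N has rank one,
   which gives both conclusions. *)
Require Import Defs.
From HB Require Import structures.
From mathcomp Require Import all_boot all_order all_algebra.
From mathcomp Require Import all_classical all_reals all_analysis.
From mathcomp Require Import ring.
Import Order.TTheory GRing.Theory Num.Theory.
Import numFieldNormedType.Exports.
Local Open Scope classical_set_scope.
Local Open Scope ring_scope.

(* Locked because [done] and [ring] otherwise unfold it to matrix products when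
   comparing atoms, and diverge in practice. *)
HB.lock Definition pairing (F : pzRingType) (n : nat)
  (X : 'rV[F]_n) (z : 'cV[F]_n) : F := (X *m z) 0 0.

Arguments pairing {F n}.

(** * Linear algebra of endomorphisms that are scalar plus rank one *)

Section RankOne.
Set Implicit Arguments.
Unset Strict Implicit.
Variables (F : numFieldType) (n : nat).
Implicit Types (X Y U : 'rV[F]_n) (z t v : 'cV[F]_n) (E : 'M[F]_n).

Lemma pairingDl X Y z : pairing (X + Y) z = pairing X z + pairing Y z.
Proof. by rewrite !pairing.unlock mulmxDl mxE. Qed.

Lemma pairingZl a X z : pairing (a *: X) z = a * pairing X z.
Proof. by rewrite !pairing.unlock -scalemxAl mxE. Qed.

Lemma pairingDr X z t : pairing X (z + t) = pairing X z + pairing X t.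
Proof. by rewrite !pairing.unlock mulmxDr mxE. Qed.

Lemma pairingZr a X z : pairing X (a *: z) = a * pairing X z.
Proof. by rewrite !pairing.unlock -scalemxAr mxE. Qed.

Lemma pairing_delta X i : pairing X (delta_mx i 0) = X 0 i.
Proof. by rewrite !pairing.unlock -colE mxE. Qed.

Lemma mulmx_pairing X z : X *m z = (pairing X z)%:M.
Proof. by rewrite pairing.unlock [LHS]mx11_scalar. Qed.

Lemma pairing_rank1 X z u (w : 'rV[F]_n) :
  pairing (X *m (u *m w)) z = pairing X u * pairing w z.
Proof.
rewrite !pairing.unlock mulmxA [X *m u in LHS]mx11_scalar.
by rewrite mul_scalar_mx -scalemxAl mxE.
Qed.

Definition pairingE :=
  (pairingDl, pairingZl, pairingDr, pairingZr, pairing_delta).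

(** Certifies that [X] and [Y] are independent and reads off coordinates on their span. *)
Definition dual_pair X Y z t :=
  [/\ pairing X z = 1, pairing Y z = 0, pairing X t = 0 & pairing Y t = 1].

(** Cramer's rule for the minor of [X], [Y] in columns [i], [j]. *)
Lemma dual_pair_exists X Y i j :
  X 0 i * Y 0 j - X 0 j * Y 0 i != 0 -> exists z t, dual_pair X Y z t.
Proof.
move=> D0; set D := X 0 i * Y 0 j - X 0 j * Y 0 i in D0.
exists ((Y 0 j / D) *: delta_mx i 0 + (- Y 0 i / D) *: delta_mx j 0).
exists ((- X 0 j / D) *: delta_mx i 0 + (X 0 i / D) *: delta_mx j 0).
by split; rewrite !pairingE; apply: (mulIf D0); rewrite /D; field.
Qed.

Lemma dual_pair_span X Y z t U : dual_pair X Y z t ->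
  (forall v, pairing X v = 0 -> pairing Y v = 0 -> pairing U v = 0) ->
  U = pairing U z *: X + pairing U t *: Y.
Proof.
move=> [Xz Yz Xt Yt] UXY; apply/rowP => k.
(* The [k]-th basis covector, projected along [z] and [t] into the common kernel of [X] and [Y]. *)
have := UXY (delta_mx k 0 + (- X 0 k) *: z + (- Y 0 k) *: t).
rewrite !pairingE Xz Yz Xt Yt => /(_ ltac:(ring) ltac:(ring)) Uk.
by rewrite !mxE; apply/eqP; rewrite -subr_eq0 -Uk; apply/eqP; ring.
Qed.

(** The projection [Q] onto the common kernel has trace [n - 2], which is nonzero in characteristic
    zero; a nonzero entry of [Q] gives [v] as its column and [U] as its row index. *)
Lemma dual_pair_kernel X Y z t : dual_pair X Y z t -> n != 2%N ->
  exists U v, [/\ pairing X v = 0, pairing Y v = 0 & pairing U v != 0].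
Proof.
move=> [Xz Yz Xt Yt] n2.
pose Q := 1%:M - (z *m X + t *m Y).
have [i [k Qki]] : exists i k, Q k i != 0.
  apply: contrapT => Q0; move: n2; rewrite -(eqr_nat F) => /eqP; apply.
  have : \tr Q = 0.
    rewrite /mxtrace big1 // => i _; apply/eqP/negPn/negP => Qii.
    by apply: Q0; exists i, i.
  rewrite /Q linearB linearD /= mxtrace1 !(mxtrace_mulC _ X) !(mxtrace_mulC _ Y).
  rewrite !mulmx_pairing !mxtrace_scalar Xz Yt => /eqP.
  by rewrite subr_eq0 => /eqP ->.
have colQ : col i Q = delta_mx i 0 + (- X 0 i) *: z + (- Y 0 i) *: t.
  by apply/colP => l; rewrite !mxE !big_ord1 eqxx andbT; ring.
exists (delta_mx 0 k), (col i Q); split; last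
  by rewrite !pairing.unlock -rowE 2!mxE.
- by rewrite colQ !pairingE Xz Xt; ring.
- by rewrite colQ !pairingE Yz Yt; ring.
Qed.

(** If every vector is an eigenvector, basis vectors show that [E] is diagonal and sums of two of
    them equate its diagonal entries. *)
Lemma nonscalar_minor E : (forall a, E <> a%:M) ->
  exists X i j, X 0 i * (X *m E) 0 j - X 0 j * (X *m E) 0 i != 0.
Proof.
move=> Ens; apply: contrapT => minor0.
have {}minor0 X i j : X 0 i * (X *m E) 0 j = X 0 j * (X *m E) 0 i.
  apply/eqP; rewrite -subr_eq0; apply/negPn/negP => D0.
  by apply: minor0; exists X, i, j.
have offdiag i j : i != j -> E i j = 0.
  move=> ij; have := minor0 (delta_mx 0 i) i j.
  by rewrite -rowE !mxE !eqxx (eq_sym j) (negbTE ij) mul1r mul0r.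
have diag i j : i != j -> E i i = E j j.
  move=> ij; have := minor0 (delta_mx 0 i + delta_mx 0 j) i j.
  rewrite mulmxDl -!rowE !mxE !eqxx (eq_sym j i) (negbTE ij) /=.
  by rewrite (offdiag i j) // (offdiag j i) 1?eq_sym // !(addr0, add0r, mul1r).
case: (posnP n) => [n0|n0].
  by apply: (Ens 0); apply/matrixP => -[i ilt]; exfalso; rewrite n0 in ilt.
pose o := Ordinal n0; apply: (Ens (E o o)); apply/matrixP => i j.
rewrite mxE; case: (altP (i =P j)) => [<-|/offdiag //].
by case: (altP (o =P i)) => [<- //|/diag].
Qed.

Definition quad E (e f : F) X z : F :=
  pairing (X *m E *m E) z + e * pairing (X *m E) z + f * pairing X z.

(* The bivector identity k EX ^ EY + X ^ SY + SX ^ Y = 0 for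
   S = E^2 + e E + f, evaluated on pairs of covectors. *)
Definition wedge_identity (k : F) E (e f : F) := forall X Y z t,
  k * (pairing (X *m E) t * pairing (Y *m E) z
       - pairing (X *m E) z * pairing (Y *m E) t)
  + pairing X t * quad E e f Y z + quad E e f X t * pairing Y z
  - pairing X z * quad E e f Y t - quad E e f X z * pairing Y t = 0.

(** Put N = E - m. Expanding k EX ^ EY leaves k m (NX ^ Y + X ^ NY), absorbed by [e], and k m^2 X ^
    Y, shared equally by the two terms in S; hence [k / 2]. *)
Lemma wedge_identity_shift k E e f m : wedge_identity k E e f ->
  wedge_identity k (E - m%:M) (e + (2 + k) * m)
    (f + e * m + (1 + k / 2) * m ^+ 2).
Proof.
move=> EH X Y z t; rewrite -(EH X Y z t) /quad.
have N1 X' : X' *m (E - m%:M) = X' *m E + (- m) *: X'.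
  by rewrite mulmxBr mul_mx_scalar scaleNr.
rewrite !N1 !mulmxDl -!scalemxAl !pairingE.
by field.
Qed.

(* Take Y = EX: modulo X the identity becomes (1 - k) X ^ EX ^ E^2 X = 0. *)
Lemma wedge_identity_local k E e f X z t :
  wedge_identity k E e f -> k != 1 -> dual_pair X (X *m E) z t ->
  exists r s, X *m E *m E = r *: (X *m E) + s *: X.
Proof.
move=> EH k1 d; have [Xz Yz Xt Yt] := d.
exists (pairing (X *m E *m E) t), (pairing (X *m E *m E) z); rewrite addrC.
apply: (dual_pair_span d) => v Xv Yv.
have := EH X (X *m E) t v; rewrite /quad Xt Yt Xv Yv => H.
apply: (mulfI (x := 1 - k)); first by rewrite subr_eq0 eq_sym.
by rewrite mulr0 -H; ring.
Qed.

(* The coefficient of EX in E^2 X cancels e, so SX is a multiple of X; the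
   identity then gives EY = b X + a EX, and comparing the EX-components forces
   (k - 1) b = 0. *)
Lemma wedge_identity_rank1 k E e f s X z t :
  wedge_identity k E e f -> k != 0 -> k != 1 -> n != 2%N ->
  dual_pair X (X *m E) z t -> X *m E *m E = - e *: (X *m E) + s *: X ->
  E = E *m t *m (X *m E).
Proof.
move=> EH k0 k1 n2 d XEE; have [Xz Yz Xt Yt] := d.
have YEv Y v :
    pairing X v = 0 -> pairing (X *m E) v = 0 -> pairing (Y *m E) v = 0.
  move=> Xv Yv; have := EH X Y t v.
  rewrite /quad XEE !pairingE Xt Yt Xv Yv => H; apply: (mulfI k0).
  by apply: oppr_inj; rewrite mulr0 oppr0 -H; ring.
have YE Y : Y *m E = pairing (Y *m E) z *: X + pairing (Y *m E) t *: (X *m E).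
  by apply: (dual_pair_span d) => v; exact: YEv.
(* A covector [v] that kills [X] and [X *m E] kills the whole image of [E], so the identity at [z],
   [v] reduces to -(2f + s) times the pairing of [Y] with [v]. *)
have sf : 2 * f + s = 0.
  have [Y [v [Xv Yv vl]]] := dual_pair_kernel d n2.
  have := EH X Y z v.
  rewrite /quad XEE !pairingE Xz Yz Xv Yv !(YEv _ v Xv Yv) => H.
  apply: (mulIf vl); apply: oppr_inj.
  by rewrite mul0r oppr0 -H; ring.
have YEz Y : pairing (Y *m E) z = 0.
  have := EH X Y z t; rewrite /quad XEE !pairingE Xz Yz Xt Yt.
  have -> : pairing (Y *m E *m E) t =
      pairing (Y *m E) z - e * pairing (Y *m E) t.
    rewrite {1}(YE Y) mulmxDl -!scalemxAl XEE !pairingE Xt Yt; ring.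
  have -> : s = - (2 * f) by apply/eqP; rewrite -addr_eq0 addrC sf.
  move=> H; apply: (mulfI (x := k - 1)); first by rewrite subr_eq0.
  by rewrite mulr0 -H; ring.
apply/row_matrixP => i; rewrite !rowE {1}YE YEz scale0r add0r.
by rewrite !mulmxA -!(mulmxA _ X) mulmx_pairing mul_scalar_mx.
Qed.

Lemma wedge_identity_nonscalar k E e f :
  wedge_identity k E e f -> k != 0 -> k != 1 -> n != 2%N ->
  (forall a, E <> a%:M) ->
  exists r u (w : 'rV_n), let m := - (e + r) / k in
    E = m%:M + u *m w /\ pairing w u = r - 2 * m.
Proof.
move=> EH k0 k1 n2 /nonscalar_minor[X [i [j /dual_pair_exists[z [t d]]]]].
have [r [s XEE]] := wedge_identity_local EH k1 d.
have [Xz Yz Xt Yt] := d.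
(* The solution of r - 2m = -(e + (2 + k) m): after the shift, the coefficient of XN in XNN is minus
   the shifted [e]. *)
pose m := - (e + r) / k; pose N := E - m%:M.
have XN Y : Y *m N = Y *m E + (- m) *: Y.
  by rewrite mulmxBr mul_mx_scalar scaleNr.
have XNN : X *m N *m N =
    (r - 2 * m) *: (X *m N) + (s + r * m - m ^+ 2) *: X.
  rewrite !XN mulmxDl -scalemxAl XEE; apply/rowP => l.
  by rewrite !mxE; move: (\sum_j _) => y; ring.
(* The correction [m *: t] restores duality once XE is replaced by XN = XE - mX. *)
have dN : dual_pair X (X *m N) (z + m *: t) t.
  by split; rewrite ?XN ?pairingE ?Xz ?Yz ?Xt ?Yt; ring.
exists r, (N *m t), (X *m N); rewrite -/m; split; last first.
  have -> : pairing (X *m N) (N *m t) = pairing (X *m N *m N) t.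
    by rewrite !pairing.unlock !mulmxA.
  by rewrite XNN !pairingE; have [_ _ -> ->] := dN; ring.
have eN : - (e + (2 + k) * m) = r - 2 * m by rewrite /m; field.
rewrite -eN in XNN.
rewrite -(wedge_identity_rank1
  (wedge_identity_shift m EH) k0 k1 n2 dN XNN).
by rewrite addrC subrK.
Qed.

(** The rank-one part squares to [pairing w u] times itself, and that scalar is its trace. *)
Lemma sqr_scalar_add_rank1 E a u (w : 'rV[F]_n) : E = a%:M + u *m w ->
  let r := pairing w u + 2 * a in
  E *m E = r *: E + (a ^+ 2 - r * a)%:M /\ \tr E = n%:R * a + pairing w u.
Proof.
move=> EE; split.
  rewrite {1 2}EE mulmxDl !mulmxDr !mul_scalar_mx !mul_mx_scalar mulmxA.
  rewrite -(mulmxA u w u) mulmx_pairing mul_mx_scalar -scalemxAl EE.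
  apply/matrixP => i j; rewrite !mxE.
  by case: (i == j); rewrite /= ?mulr1n ?mulr0n; ring.
rewrite EE linearD /= mxtrace_scalar mxtrace_mulC mulmx_pairing mxtrace_scalar.
by rewrite mulr1n mulr_natl.
Qed.

(** For [a] = 0 both S and the bivector NX ^ NY vanish; shifting by [- a] gives the general case. *)
Lemma rank1_wedge_identity k a u (w : 'rV[F]_n) :
  wedge_identity k (a%:M + u *m w) (- pairing w u - (2 + k) * a)
    (pairing w u * a + (1 + k / 2) * a ^+ 2).
Proof.
have H0 : wedge_identity k (u *m w) (- pairing w u) 0.
  by move=> X Y z t; rewrite /quad !pairing_rank1; ring.
have := wedge_identity_shift (- a) H0.
rewrite raddfN /= opprK addrC mulrN sqrrN.
by rewrite (_ : 0 + - pairing w u * - a = pairing w u * a); last by ring.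
Qed.

End RankOne.

(** * Translation between symmetric forms and endomorphisms *)

Section SymmetricForms.
Set Implicit Arguments.
Unset Strict Implicit.
Variables (R : realType) (n : nat) (g A : {symmetric 'rV[R]_n}).
Hypothesis gnd : nondegenerate g.
Let E := endo g A.
Local Notation form f := (f : _ -> _ -> R^o).
Let covector (Y : 'rV[R]_n) : 'cV[R]_n := matrix_of_form g *m Y^T.

Let gE X Y : g X Y = pairing X (covector Y).
Proof. by rewrite symmetric_mxE pairing.unlock mulmxA. Qed.

Let AE X Y : A X Y = pairing (X *m E) (covector Y).
Proof. by rewrite -gE endoP. Qed.

Let sqE X Y : sq g A X Y = pairing (X *m E *m E) (covector Y).
Proof. by rewrite /sq AE. Qed.

Let covector_surj z : exists Z, covector Z = z.
Proof.
exists (invmx (matrix_of_form g) *m z)^T.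
by rewrite /covector trmxK mulKVmx // nondegenerate_unit.
Qed.

Let scaleE (b : R) (c : R^o) : b *: c = b * c. Proof. by []. Qed.

Lemma tr_sq : tr g (sq g A) = \tr (E *m E).
Proof.
rewrite /tr (endo_unique (E := E *m E)) // => X Y.
by rewrite gE sqE mulmxA.
Qed.

(** Lowering the last two arguments with [g] reaches every covector, by nondegeneracy. The half
    appears because [KN A A] counts each minor of [A] twice. *)
Lemma KN_wedge_identity (k e f : R) :
  KN g (sq g A) + (k / 2) *: KN A A - e *: KN g A + f *: KN g g = 0 <->
  wedge_identity k E (- e) f.
Proof.
have KNE X Y Z T :
    (KN g (sq g A) + (k / 2) *: KN A A - e *: KN g A + f *: KN g g) X Y Z T =
    let z := covector Z in let t := covector T in
    k * (pairing (X *m E) t * pairing (Y *m E) z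
         - pairing (X *m E) z * pairing (Y *m E) t)
    + pairing X t * quad E (- e) f Y z + quad E (- e) f X t * pairing Y z
    - pairing X z * quad E (- e) f Y t - quad E (- e) f X z * pairing Y t.
  by rewrite !fctE /KN /quad /= !sqE !AE !gE /GRing.scale /=; field.
split=> [W0 X Y z t|W].
  have [Z <-] := covector_surj z; have [T <-] := covector_surj t.
  by have := KNE X Y Z T; rewrite W0 /= => <-.
by apply/funext => X; apply/funext => Y; apply/funext => Z; apply/funext => T;
  rewrite KNE /= W.
Qed.

(** The shifted form is a product of two linear forms, so its minors vanish. *)
Lemma endo_rank1_KN a u (w : 'rV_n) : E = a%:M + u *m w ->
  KN (form A - a *: form g) (form A - a *: form g) = 0.
Proof.
move=> EE.
have BE X Y : (form A - a *: form g) X Y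
    = pairing X u * pairing w (covector Y).
  rewrite !fctE /= AE gE EE mulmxDr mul_mx_scalar !pairingE pairing_rank1.
  by rewrite addrAC subrr add0r.
apply/funext => X; apply/funext => Y; apply/funext => Z; apply/funext => T.
by rewrite /KN !BE; transitivity (0 : R); first by ring.
Qed.

(** E^2 is a multiple of E plus a scalar, and removing traces cancels the scalar. *)
Lemma endo_rank1_sq a u (w : 'rV_n) : (0 < n)%N -> E = a%:M + u *m w ->
  sq g A - (tr g (sq g A) / n%:R) *: form g =
    (pairing w u + 2 * a) *: (form A - (tr g A / n%:R) *: form g).
Proof.
move=> n0 EE; have [EE2 _] := sqr_scalar_add_rank1 EE; rewrite /= in EE2.
have n0' : n%:R != 0 :> R by rewrite pnatr_eq0 -lt0n.
rewrite tr_sq /tr -/E EE2 mxtraceD mxtraceZ mxtrace_scalar -[_ *+ n]mulr_natl.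
apply/funext => X; apply/funext => Y; rewrite !fctE /= sqE AE gE.
rewrite -mulmxA EE2 mulmxDr -scalemxAr mul_mx_scalar !pairingE !scaleE.
by field.
Qed.

Lemma endo_nonscalar a : (0 < n)%N ->
  form A <> (tr g A / n%:R) *: form g -> E <> a%:M.
Proof.
move=> n0 UA Ea; apply: UA; apply/funext => X; apply/funext => Y.
have n0' : n%:R != 0 :> R by rewrite pnatr_eq0 -lt0n.
rewrite !fctE /= AE gE /tr -/E Ea mxtrace_scalar -[_ *+ n]mulr_natl.
by rewrite mul_mx_scalar pairingZl scaleE; field.
Qed.

(** Factor the Gram matrix as column times row, then raise an index with the inverse of that of
    [g]. *)
Lemma rank_form_endo a :
  rank_form (form A - a *: form g) = 1%N ->
  exists u (w : 'rV_n), E = a%:M + u *m w.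
Proof.
rewrite /rank_form; set B := matrix_of_form _ => B1.
have [u [w Buw]] : exists (u : 'cV_n) (w : 'rV_n), B = u *m w.
  move: (mulmx_base B); move: (col_base B) (row_base B); rewrite B1 => u w <-.
  by exists u, w.
exists u, (w *m invmx (matrix_of_form g)).
have AB : matrix_of_form A = a *: matrix_of_form g + u *m w.
  by rewrite -Buw; apply/matrixP => i j; rewrite !mxE !fctE /= addrC subrK.
apply: (endo_unique gnd) => X Y.
rewrite !symmetric_mxE AB; congr (fun_of_matrix (_ *m _) 0 0).
rewrite -mulmxA mulmxDl mul_scalar_mx -!mulmxA mulVmx ?mulmx1 //.
exact: nondegenerate_unit.
Qed.

End SymmetricForms.

Theorem proposition2p1 (R : realType) (n : nat) (M : manifold R n)
  (g A : sym_tensor M) :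
  (4 <= n)%N ->
  (forall p, nondegenerate (tensor_form g p)) ->
  let U_A := [set p : M | A p <> (tr (g p) (A p) / n%:R) *: g p] in
  (forall alpha : M -> R,
     (forall p, U_A p -> rank_form (A p - alpha p *: g p) = 1%N) ->
     forall p, U_A p ->
       KN (g p) (sq (g p) (A p)) + ((n%:R - 2) / 2) *: KN (A p) (A p)
         - tr (g p) (A p) *: KN (g p) (A p)
         + ((tr (g p) (A p) ^+ 2 - tr (g p) (sq (g p) (A p)))
              / (2 * (n%:R - 1))) *: KN (g p) (g p) = 0
       /\
       sq (g p) (A p) - (tr (g p) (sq (g p) (A p)) / n%:R) *: g p
         = (tr (g p) (A p) - (n%:R - 2) * alpha p)
             *: (A p - (tr (g p) (A p) / n%:R) *: g p))
  /\
  ((forall p, U_A p ->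
      KN (g p) (sq (g p) (A p)) + ((n%:R - 2) / 2) *: KN (A p) (A p)
        - tr (g p) (A p) *: KN (g p) (A p)
        + ((tr (g p) (A p) ^+ 2 - tr (g p) (sq (g p) (A p)))
             / (2 * (n%:R - 1))) *: KN (g p) (g p) = 0) ->
   exists rho : M -> R, forall p, U_A p ->
     sq (g p) (A p) - (tr (g p) (sq (g p) (A p)) / n%:R) *: g p
       = rho p *: (A p - (tr (g p) (A p) / n%:R) *: g p)
     /\
     KN (A p - ((tr (g p) (A p) - rho p) / (n%:R - 2)) *: g p)
        (A p - ((tr (g p) (A p) - rho p) / (n%:R - 2)) *: g p) = 0).
Proof.
move=> n4 gnd U_A.
have n0 : (0 < n)%N by apply: leq_trans n4.
have n0' : n%:R != 0 :> R by rewrite pnatr_eq0 -lt0n.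
have n1 : n%:R - 1 != 0 :> R.
  by rewrite subr_eq0 pnatr_eq1 neq_ltn (leq_trans _ n4) ?orbT.
have nk : n%:R - 2 = (n - 2)%:R :> R by rewrite natrB // (leq_trans _ n4).
split=> [alpha Hr p Up|HW].
  have [u [w Ep]] := rank_form_endo (gnd p) (Hr p Up).
  have [EE2 trE] := sqr_scalar_add_rank1 Ep.
  have trA : tr (g p) (A p) = n%:R * alpha p + pairing w u by [].
  have trA2 : tr (g p) (sq (g p) (A p)) =
      (pairing w u + 2 * alpha p) * tr (g p) (A p)
      + n%:R * (alpha p ^+ 2 - (pairing w u + 2 * alpha p) * alpha p).
    rewrite [LHS](tr_sq (tensor_form A p) (gnd p)) EE2.
    by rewrite mxtraceD mxtraceZ mxtrace_scalar -[_ *+ n]mulr_natl.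
  have sqp := endo_rank1_sq (gnd p) n0 Ep.
  have := rank1_wedge_identity (n%:R - 2) (alpha p) u w.
  rewrite -Ep => W; split.
    refine
      ((KN_wedge_identity (tensor_form A p) (gnd p) (n%:R - 2) _ _).2 _).
    (* With c = [pairing w u] and a = [alpha p], the numerator of the last coefficient is (n - 1)(n
       a^2 + 2 c a), so n - 1 cancels. *)
    rewrite trA2 trA.
    rewrite [X in wedge_identity _ _ X _](_ : _ =
      - pairing w u - (2 + (n%:R - 2)) * alpha p); last by ring.
    rewrite [X in wedge_identity _ _ _ X](_ : _ =
      pairing w u * alpha p + (1 + (n%:R - 2) / 2) * alpha p ^+ 2) //.
    by field; rewrite n1.
  rewrite [LHS]sqp; congr (_ *: _); rewrite trA; ring.
have rhoP p : exists rho : R, U_A p ->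
     sq (g p) (A p) - (tr (g p) (sq (g p) (A p)) / n%:R) *: g p
       = rho *: (A p - (tr (g p) (A p) / n%:R) *: g p)
     /\
     KN (A p - ((tr (g p) (A p) - rho) / (n%:R - 2)) *: g p)
        (A p - ((tr (g p) (A p) - rho) / (n%:R - 2)) *: g p) = 0.
  (* The value 0 off [U_A] is a dummy that makes [rho] total. *)
  have [Up|nUp] := pselect (U_A p); last by exists 0.
  have W :=
    (KN_wedge_identity (tensor_form A p) (gnd p) (n%:R - 2) _ _).1 (HW p Up).
  have [|||a|r [u [w [Ep wu]]]] := wedge_identity_nonscalar W.
  - by rewrite nk pnatr_eq0 subn_eq0 -ltnNge (leq_trans _ n4).
  - by rewrite nk pnatr_eq1 neq_ltn ltn_subRL (leq_trans _ n4) ?orbT.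
  - by rewrite neq_ltn (leq_trans _ n4) ?orbT.
  - exact: (endo_nonscalar (gnd p) n0 Up).
  (* Here [e] is minus the trace, so the shift [m] becomes (tr A - rho)/(n - 2). *)
  exists r => _; rewrite opprD opprK in Ep wu; split.
    by rewrite [LHS](endo_rank1_sq (gnd p) n0 Ep) wu subrK.
  exact: (endo_rank1_KN (gnd p) Ep).
exists (fun p => projT1 (cid (rhoP p))) => p.
exact: (projT2 (cid (rhoP p))).
Qed.
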